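(* Let $p>5$ be a prime. The polynomial $f_{5p}$ is separable over $\mathbb{F}_p$ (i.e. its reduction modulo $p$ has no repeated root in $\overline{\mathbb{F}}_p$), and hence it is also separable over $\mathbb{Z}$. Consequently, $g_{5p}$ is separable as well.
   Context: For an integer $n>1$, $F_n(x)=\sum_{0\le a\le n-1,\ \gcd(a,n)=1}x^a\in\mathbb{Z}[x]$. For $n=pq$ with odd primes $p>q$, let $$S_n=\{d>1 : d\neq q,\ d\mid p-1\}\cup\{d>1 : d\mid q-1\}\cup\{d>1 : d\mid\gcd(pq+1,p+q)\}.$$ The polynomial $f_n\in\mathbb{Z}[x]$ is defined by $F_n(x)=f_n(x)\cdot x\cdot\prod_{d\in S_n}\Phi_d(x)$, where $\Phi_d$ is the $d$-th cyclotomic polynomial. $f_n$ is a reciprocal polynomial of even degree, and $g_n$ denotes its trace polynomial: the unique polynomial with $g_n\left(x+\frac1x\right)=x^{-\deg(f_n)/2}f_n(x)$. Here $q=5$ and $n=5p$. A polynomial in $\mathbb{Z}[x]$ is separable (over $\mathbb{Z}$) if it has no repeated root in $\overline{\mathbb{Q}}$. *)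

(* Defs.v *)
From HB Require Import structures.
From mathcomp Require Import all_boot all_order all_algebra all_field.

Set Implicit Arguments.
Unset Strict Implicit.
Unset Printing Implicit Defensive.

Import GRing.Theory.
Local Open Scope ring_scope.

Definition F_poly (n : nat) : {poly int} :=
  \sum_(0 <= a < n | coprime a n) 'X^a.

(* [undup] makes this the set-theoretic union: each d occurs only once. *)
Definition S_seq (p q : nat) : seq nat :=
  undup ([seq d <- divisors (p - 1) | (1 < d)%N && (d != q)]
      ++ [seq d <- divisors (q - 1) | (1 < d)%N]
      ++ [seq d <- divisors (gcdn (p * q + 1) (p + q)) | (1 < d)%N]).

(* f is the polynomial f_n for n = p * q.  It is unique since the cofactor of f
   is monic. *)
Definition is_f_poly (p q : nat) (f : {poly int}) : Prop :=
  F_poly (p * q) = f * 'X * \prod_(d <- S_seq p q) 'Phi_d.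

(* g (x + 1/x) = x ^ (- deg f / 2) * f (x) in the fraction field of Z[x], where
   deg f is [(size f).-1] and is meant to be even. *)
Definition is_trace_poly (f g : {poly int}) : Prop :=
  let x : {fraction {poly int}} := tofrac 'X in
  (map_poly intr g).[x + x^-1] = x ^- ((size f).-1)./2 * tofrac f.

(* The zero polynomial has repeated roots in this sense. *)
Definition has_repeated_root (K : fieldType) (P : {poly K}) : Prop :=
  exists x : K, ('X - x%:P) ^+ 2 %| P.

(* [algC] is the algebraic closure of the rationals. *)
Definition separable_Z (f : {poly int}) : Prop :=
  ~ has_repeated_root (map_poly (intr : int -> algC) f).

Definition Fp_bar (p : nat) : countClosedFieldType :=
  projT1 (countable_algebraic_closure 'F_p).

(* 'F_p is the field with p elements when p is prime; the integers map to
   [Fp_bar p] through it. *)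
Definition Fp_bar_inj (p : nat) : {rmorphism 'F_p -> Fp_bar p} :=
  sval (projT2 (countable_algebraic_closure 'F_p)).

Definition separable_mod (p : nat) (f : {poly int}) : Prop :=
  ~ has_repeated_root
      (map_poly (Fp_bar_inj p) (map_poly (intr : int -> 'F_p) f)).

(* Main.v *)
Require Import Defs.
From mathcomp Require Import all_boot all_order all_algebra all_field.
From mathcomp Require Import ring zify.

(** Let [K] be an algebraic closure of the field with [p] elements, [n = 5 * p],
    [u = X^5 - 1] and [Phi5] the fifth cyclotomic polynomial.  By
    inclusion-exclusion and Frobenius, [F_n] satisfies over [K]

      [G := (X - 1) * F_n
          = u ^ p - (X - 1) * Phi5 ^ p - (X - 1) * u ^ (p - 1) + (X - 1)]

    (lemma [map_F_poly]), and [G'] is explicit too, since [p]-th powers have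
    zero derivative.  If [x] is a repeated root of [F_n], then [G = G' = 0] at
    [x] gives [Phi5 x ^ 2 = 5 * x ^ 4], so [Phi5 x = s * x ^ 2] with
    [s ^ 2 = 5].  With [y = x ^ p], and [eps = 1] or [-1] the sign such that
    [s ^ p = eps * s], one has [Phi5 y = eps * s * y ^ 2], and [G = 0] becomes
    a polynomial relation between [x], [y] and [s] (lemma
    [repeated_root_relations]).  There are three cases.

    - If [eps = 1] and [y = x], then [x ^ (p - 1) = 1], so [x] is a root of the
      cofactor of [f].  A repeated root of [f] is then a triple root of [F_n],
      and [G'' = 0] forces [p = 11] (lemma [triple_root_elimination]).
    - If [eps = 1] and [y <> x], elimination shows that the equations are
      inconsistent (lemma [pos_sign_elimination]).
    - If [eps = -1], elimination gives [p = 17] (lemma [neg_sign_elimination]).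

    In characteristics 11 and 17 the equations of the first and of the last case
    do have solutions, but there [y] is not [x ^ p].  So [f] has no repeated root
    modulo [p] (lemma [no_repeated_root]).

    As [f] is monic, a repeated root in characteristic zero yields by Gauss's
    lemma a square factor over the integers with unit leading coefficient, which
    survives reduction (lemma [separable_Z_of_reduction]).  Finally, a repeated
    root [b] of [g] gives the factor [(X^2 - b * X + 1) ^ 2] of [f], up to a
    power of [X] (lemma [separable_Z_trace]). *)

Set Implicit Arguments.
Unset Strict Implicit.
Unset Printing Implicit Defensive.

Import GRing.Theory.
Local Open Scope ring_scope.

(** * Linear combinations of equations *)

(** To derive [a = b] from equations [l = r], it suffices to exhibit [a - b] as
    a combination of the differences [l - r], an identity left to [ring] or
    [field]. *)
Lemma lincomb1 (R : pzRingType) (c1 l1 r1 a b : R) :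
  l1 = r1 -> a - b = c1 * (l1 - r1) -> a = b.
Proof. by move=> ->; rewrite subrr mulr0 => /subr0_eq. Qed.

Lemma lincomb2 (R : pzRingType) (c1 c2 l1 r1 l2 r2 a b : R) :
  l1 = r1 -> l2 = r2 -> a - b = c1 * (l1 - r1) + c2 * (l2 - r2) -> a = b.
Proof. by move=> -> ->; rewrite !subrr !mulr0 addr0 => /subr0_eq. Qed.

Lemma lincomb3 (R : pzRingType) (c1 c2 c3 l1 r1 l2 r2 l3 r3 a b : R) :
  l1 = r1 -> l2 = r2 -> l3 = r3 ->
  a - b = c1 * (l1 - r1) + c2 * (l2 - r2) + c3 * (l3 - r3) -> a = b.
Proof. by move=> -> -> ->; rewrite !subrr !mulr0 !addr0 => /subr0_eq. Qed.

Lemma lincomb4 (R : pzRingType)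
    (c1 c2 c3 c4 l1 r1 l2 r2 l3 r3 l4 r4 a b : R) :
  l1 = r1 -> l2 = r2 -> l3 = r3 -> l4 = r4 ->
  a - b = c1 * (l1 - r1) + c2 * (l2 - r2) + c3 * (l3 - r3) + c4 * (l4 - r4) ->
  a = b.
Proof. by move=> -> -> -> ->; rewrite !subrr !mulr0 !addr0 => /subr0_eq. Qed.

Arguments lincomb1 {R} c1 {l1 r1 a b}.
Arguments lincomb2 {R} c1 c2 {l1 r1 l2 r2 a b}.
Arguments lincomb3 {R} c1 c2 c3 {l1 r1 l2 r2 l3 r3 a b}.
Arguments lincomb4 {R} c1 c2 c3 c4 {l1 r1 l2 r2 l3 r3 l4 r4 a b}.

(** * The equations of a repeated root *)

(** The value at [x] of the fifth cyclotomic polynomial. *)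
Definition Phi5 (R : nzRingType) (x : R) := 1 + x + x ^+ 2 + x ^+ 3 + x ^+ 4.

Section Elimination.

Variable K : fieldType.
Hypothesis two_neq0 : (2 : K) != 0.
Hypothesis five_neq0 : (5 : K) != 0.

Let four_neq0 : (4 : K) != 0.
Proof. by rewrite (natrM _ 2 2) mulf_neq0. Qed.

(** The conditions for a triple root [x] of [F_n] with [x ^+ p = x]; the last
    one is the vanishing of the second derivative. In terms of [x + x^-1] the
    conclusion says [x + x^-1 = - 1 / 2], which meets [(t ^+ 2 + t - 1) ^+ 2 =
    5] only in characteristic 11. *)
Lemma triple_root_elimination (x s : K) :
  s ^+ 2 = 5 -> x != 0 -> x - 1 != 0 ->
  Phi5 x = s * x ^+ 2 ->
  s * (3 * x - 2) = 5 * x ^+ 3 ->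
  (11 : K) = 0 /\ 2 * x ^+ 2 + x + 2 = 0.
Proof.
rewrite /Phi5 => hs x0 x1 hx ht.
have /eqP : (x - 1) ^+ 2 * ((x + 1) * (2 * x ^+ 2 + x + 2)) = 0.
  apply: (mulfI x0).
  by apply: (lincomb2 (- x * (3 * x - 2)) (- x ^+ 3) hx ht); ring.
rewrite mulf_eq0 expf_eq0 (negPf x1) mulf_eq0 /= => /orP[] /eqP h.
  have s1 : s = 1.
    have ex : x = - 1 by apply: (lincomb1 1 h); ring.
    by move: hx; rewrite ex => hx; apply: (lincomb1 (-1) hx); ring.
  by case/eqP: four_neq0; rewrite s1 in hs; apply: (lincomb1 (-1) hs); ring.
have hs4 : 4 * s = - 5.
  apply: (mulfI (expf_neq0 2 x0)).
  by apply: (lincomb2 (-4) (2 * x ^+ 2 + x + 2) hx h); ring.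
split=> //; apply: (mulfI five_neq0).
by apply: (lincomb2 (-16) (4 * s - 5) hs hs4); ring.
Qed.

(** [F_n] is a reciprocal polynomial, so the relation between [x] and [y = x ^+
    p] at a repeated root holds for [x^-1] and [y^-1] too; cleared of
    denominators, this is the conclusion. *)
Lemma reciprocal_relation (x y s eps : K) : x != 0 -> y != 0 ->
  Phi5 x = s * x ^+ 2 ->
  Phi5 y = eps * s * y ^+ 2 ->
  eps * s * x ^+ 2 * y ^+ 2 * (y - x) - eps * (y - 1) * y ^+ 2
    + (x - 1) * x ^+ 2 = 0 ->
  eps * s * (x - y) + eps * x ^+ 3 * (y - 1) - (x - 1) * y ^+ 3 = 0.
Proof.
rewrite /Phi5 => x0 y0 hx hy hA.
apply: (mulfI (mulf_neq0 (expf_neq0 2 x0) (expf_neq0 2 y0))).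
by apply: (lincomb3 ((x - 1) * (y - 1) * eps * y ^+ 2)
  (- (x - 1) * (y - 1) * x ^+ 2) (- 1) hx hy hA); ring.
Qed.

(** If Frobenius fixes [s], it fixes every repeated root [x], as [y = x ^+ p].
    *)
Lemma pos_sign_elimination (x y s : K) : x != 0 -> y != 0 -> s ^+ 2 = 5 ->
  Phi5 x = s * x ^+ 2 ->
  Phi5 y = s * y ^+ 2 ->
  s * x ^+ 2 * y ^+ 2 * (y - x) - (y - 1) * y ^+ 2 + (x - 1) * x ^+ 2 = 0 ->
  y = x.
Proof.
rewrite /Phi5 => x0 y0 hs hx hy hA.
apply/eqP/negPn/negP; rewrite -subr_eq0 => yx.
have s0 : s != 0.
  by apply: contraNneq five_neq0 => s0; rewrite -hs s0 expr0n.
have hB : s * (x - y) + x ^+ 3 * (y - 1) - (x - 1) * y ^+ 3 = 0.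
  by rewrite -(@reciprocal_relation x y s 1) ?mul1r.
(* Both relations are divisible by [y - x]; the sum of the quotients is
   divisible by [x * y - 1]. *)
have hA1 : s * x ^+ 2 * y ^+ 2 = x ^+ 2 + x * y + y ^+ 2 - (x + y).
  by apply: (mulfI yx); apply: (lincomb1 1 hA); ring.
have hB1 : x ^+ 2 + x * y + y ^+ 2 - x * y * (x + y) = s.
  by apply: (mulfI yx); apply: (lincomb1 1 hB); ring.
have [xy1|xyN1] := eqVneq (x * y) 1.
  have ey : y = x^-1 by rewrite -[y](mulKf x0) xy1 mulr1.
  rewrite ey in hB1.
  have hx2 : x ^+ 2 = - 1.
    apply: (mulfI two_neq0).
    by apply: (lincomb2 x^-1 (- x) hx hB1); field.
  have s1 : s = - 1.
    by apply: (lincomb2 1 (s - x ^+ 2 - x) hx hx2); ring.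
  by case/eqP: four_neq0; rewrite s1 in hs; apply: (lincomb1 (-1) hs); ring.
rewrite -subr_eq0 in xyN1.
have he : x + y = s * (x * y + 1).
  by apply: (mulfI xyN1); apply: (lincomb2 (-1) (- 1) hA1 hB1); ring.
(* The difference of the quartic equations of [x] and [y]: with
   [t = x + x^-1] and [t' = y + y^-1] it says [t + t' = - 1], as [t != t']. *)
have hT : (x + y) * (x * y + 1) = - (x * y).
  apply: (mulfI (mulf_neq0 yx xyN1)).
  by apply: (lincomb2 (- y ^+ 2) (x ^+ 2) hx hy); ring.
have w0 := mulf_neq0 x0 y0.
have hsw : s * (x * y + 1) ^+ 2 = - (x * y) by rewrite -hT he; ring.
have hRC : (x + y) ^+ 2 + (x * y + 1) ^+ 2 = (3 - s) * (x * y).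
  apply: (mulfI (mulf_neq0 two_neq0 w0)).
  apply: (lincomb3 (- y ^+ 2) (- x ^+ 2) ((x + y) * (x * y + 1)) hx hy hT).
  ring.
have h3s : 3 * s = - 1.
  apply: (mulfI w0); rewrite he in hRC.
  apply: (lincomb2 (- s) (s ^+ 2 + 1) hRC hsw); ring.
have h11 : (11 : K) = 0.
  apply: (mulfI four_neq0).
  by apply: (lincomb2 (-9) (3 * s - 1) hs h3s); ring.
(* In characteristic 11 the discriminant of [t ^+ 2 + t - 1 = s] vanishes, which
   forces [y = x]. *)
case/eqP: yx.
have /eqP : s * (y - x) ^+ 2 = 0.
  have hs4 : 5 + 4 * s = 0 by apply: (lincomb2 5 (- s) h3s h11); ring.
  rewrite (_ : (y - x) ^+ 2 = (x + y) ^+ 2 - 4 * (x * y)); last by ring.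
  rewrite he.
  by apply: (lincomb3 (s ^+ 2) (- x * y) (- x * y) hsw hs hs4); ring.
by rewrite mulf_eq0 expf_eq0 /= (negPf s0) /= => /eqP.
Qed.

(** If Frobenius maps [s] to [- s], a repeated root [x], with [y = x ^+ p], is
    only possible in characteristic 17, and there [x * y] is a primitive cube
    root of unity. *)
Lemma neg_sign_elimination (x y s : K) : x != 0 -> y != 0 -> s ^+ 2 = 5 ->
  Phi5 x = s * x ^+ 2 ->
  Phi5 y = - s * y ^+ 2 ->
  - s * x ^+ 2 * y ^+ 2 * (y - x) + (y - 1) * y ^+ 2 + (x - 1) * x ^+ 2 = 0 ->
  [/\ (17 : K) = 0, (x * y) ^+ 2 + x * y + 1 = 0 & (x + y) * (x * y) = - 9].
Proof.
rewrite /Phi5 => x0 y0 hs hx hy hA.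
have hB : - s * (x - y) - x ^+ 3 * (y - 1) - (x - 1) * y ^+ 3 = 0.
  rewrite -[RHS](@reciprocal_relation x y s (- 1)) ?mulN1r //; first by ring.
  by rewrite -[RHS]hA; ring.
have w0 := mulf_neq0 x0 y0.
(* [T] and [d] are the sum and the difference of [x + x^-1] and [y + y^-1].  The
   quantities [R] and [C] are the squares of [r + r^-1] and [c + c^-1], where
   [c ^+ 2 = x * y] and [r ^+ 2 = x / y]. *)
pose T := (x + y) * (x * y + 1) / (x * y).
pose C := (x * y + 1) ^+ 2 / (x * y).
pose R := (x + y) ^+ 2 / (x * y).
pose d := (x - y) * (x * y - 1) / (x * y).
have RC : R * C = T ^+ 2 by rewrite /R /C /T; field; rewrite x0 y0.
have dd : d ^+ 2 = (R - 4) * (C - 4).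
  by rewrite /R /C /d; field; rewrite x0 y0.
have hsum : 2 * (R + C) = T ^+ 2 + T + 6.
  apply: (lincomb2 (- x ^- 2) (- y ^- 2) hx hy).
  by rewrite /R /C /T; field; rewrite x0 y0.
have hdiff : d * (T + 1) = 2 * s.
  apply: (lincomb2 (x ^- 2) (- y ^- 2) hx hy).
  by rewrite /d /T; field; rewrite x0 y0.
have hAB : - s * d * C = 2 * R * T - 6 * T - T ^+ 2 + 2 * C.
  apply: (lincomb2 (- (x * y + 1) / (x * y) ^+ 2) (- (x * y + 1) / (x * y) ^+ 2)
     hA hB).
  by rewrite /d /T /R /C; field; rewrite x0 y0.
have hTw : (x + y) * (x * y + 1) = T * (x * y) by rewrite divfK.
have hCw : (x * y + 1) ^+ 2 = C * (x * y) by rewrite divfK.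
clearbody T C R d.
have quartic : T ^+ 4 + 4 * T ^+ 3 + T ^+ 2 - 6 * T + 16 = 0.
  have h1 : (4 - T ^+ 2 - 2 * T) * (T + 1) ^+ 2 = 20.
    transitivity ((d * (T + 1)) ^+ 2); last by rewrite hdiff exprMn hs; ring.
    rewrite exprMn dd; congr (_ * _).
    by apply: (lincomb2 (- 1) 2 RC hsum); ring.
  by apply: (lincomb1 (- 1) h1); ring.
have hC : 2 * C * (T ^+ 2 - 6) = (T + 1) * T ^+ 3.
  apply: (lincomb4 (T + 1) (s * C) (2 * C) ((T + 1) * T) hAB hdiff hs hsum).
  ring.
have sixteen_neq0 : (16 : K) != 0 by rewrite (natrM _ 4 4) mulf_neq0.
have T0 : T != 0.
  apply: contraNneq sixteen_neq0 => T0; apply/eqP; rewrite -quartic T0; ring.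
have hCC : 2 * C ^+ 2 - (T ^+ 2 + T + 6) * C + 2 * T ^+ 2 = 0.
  by apply: (lincomb2 (- 2) C RC hsum); ring.
have sextic : (T + 1) ^+ 2 * T ^+ 4
    - (T ^+ 2 + T + 6) * (T + 1) * T * (T ^+ 2 - 6) + 4 * (T ^+ 2 - 6) ^+ 2 = 0.
  apply: (mulfI (expf_neq0 2 T0)).
  apply: (lincomb2 (2 * (T ^+ 2 - 6) ^+ 2) ((T ^+ 2 + T + 6) * (T ^+ 2 - 6)
    - 2 * C * (T ^+ 2 - 6) - (T + 1) * T ^+ 3) hCC hC).
  ring.
(* The terms of degree 5 and 6 of [sextic] cancel, and reducing it by [quartic]
   leaves a cubic with a rational root. *)
have /eqP : (T + 2) * (T ^+ 2 - T - 4) = 0.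
  apply: (mulfI (mulf_neq0 two_neq0 five_neq0)).
  by apply: (lincomb2 4 (- 1) quartic sextic); ring.
rewrite mulf_eq0 => /orP[] /eqP hT.
  case/eqP: sixteen_neq0.
  by apply: (lincomb2 1 (- (T ^+ 3 + 2 * T ^+ 2 - 3 * T)) quartic hT); ring.
have h3T : 3 * T + 7 = 0.
  apply: (mulfI (mulf_neq0 two_neq0 four_neq0)).
  apply: (lincomb2 1 (- (T ^+ 2 + 5 * T + 10)) quartic hT); ring.
have h17 : (17 : K) = 0.
  apply: (mulfI two_neq0).
  apply: (lincomb2 9 (10 - 3 * T) hT h3T); ring.
have T9 : T = 9 by apply: (lincomb2 6 (- (T + 3)) h3T h17); ring.
rewrite T9 in hC hTw.
have C1 : C = 1 by apply: (lincomb2 11 (- (97 * C - 4717)) hC h17); ring.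
rewrite C1 in hCw.
split=> //; first by apply: (lincomb1 1 hCw); ring.
apply: (mulfI w0).
by apply: (lincomb2 (x + y) (-1) hCw hTw); ring.
Qed.

(** The solution left over in characteristic 17 has [y <> x ^+ 17]. *)
Lemma no_repeated_root_char17 (x y : K) : 17 \in [pchar K] -> y = x ^+ 17 ->
  (x * y) ^+ 2 + x * y + 1 = 0 -> (x + y) * (x * y) = - 9 -> False.
Proof.
move=> charK; set w := x * y => hy hw he.
have h17 : (17 : K) = 0 by apply: pcharf0.
have w3 : w ^+ 3 = 1 by apply: (lincomb1 (w - 1) hw); ring.
have /eqP : (x + 6 * w ^+ 2) * (x + 3 * w ^+ 2) = 0.
  have hxy : x * y = w by [].
  clearbody w.
  apply: (lincomb4 (- 1) (x * w ^+ 2) (18 * w - x * (x + y)) w hxy he w3 h17).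
  by ring.
(* The two possible values of [x] are evaluated at the power 17 by means of
   [w ^+ 3 = 1] and Fermat's little theorem. *)
have w34 : w ^+ 34 = w.
  by rewrite (exprD _ 33 1) (exprM _ 3 11) w3 expr1n mul1r.
have fermat (n : nat) : (n%:R : K) ^+ 17 = n%:R.
  exact: (pFrobenius_aut_nat charK).
have one_neq0 : (1 : K) <> 0 by apply/eqP/oner_neq0.
have hxy : x * y = w by [].
clearbody w.
rewrite mulf_eq0 => /orP[] /eqP hx.
  have ex : x = - (6 * w ^+ 2) by apply: (lincomb1 1 hx); ring.
  have ey : y = - (6 * w) by rewrite hy ex exprNn exprMn fermat -exprM w34; ring.
  have w2 : w = 2.
    by rewrite ex ey in hxy; apply: (lincomb3 (- 1) 36 2 hxy w3 h17); ring.
  by rewrite w2 in hw; apply: one_neq0; apply: (lincomb2 5 (- 2) hw h17); ring.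
have ex : x = - (3 * w ^+ 2) by apply: (lincomb1 1 hx); ring.
have ey : y = - (3 * w) by rewrite hy ex exprNn exprMn fermat -exprM w34; ring.
have w9 : w = 9.
  by rewrite ex ey in hxy; apply: (lincomb2 (- 1) 9 hxy w3); ring.
by rewrite w9 in hw; apply: one_neq0; apply: (lincomb2 3 (- 16) hw h17); ring.
Qed.

(** The solution left over in characteristic 11 does not lie in the prime
    field. *)
Lemma no_triple_root_char11 (x : K) : (11 : K) = 0 -> 2 * x ^+ 2 + x + 2 = 0 ->
  x ^+ 10 = 1 -> False.
Proof.
move=> h11 hx h10.
have x2 : x ^+ 2 = 5 * x - 1.
  by apply: (lincomb2 6 (- (x ^+ 2 + x + 1)) hx h11); ring.
have x4 : x ^+ 4 = 5 * x - 2.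
  rewrite (exprM _ 2 2) x2.
  by apply: (lincomb2 25 (10 * x - 2) x2 h11); ring.
have x5 : x ^+ 5 = x - 5.
  by rewrite exprS x4; apply: (lincomb2 5 (2 * x) x2 h11); ring.
have hx5 : 5 * x = 23.
  by rewrite (exprM _ 5 2) x5 in h10; apply: (lincomb2 (- 1) 1 h10 x2); ring.
have ex : x = - 2 by apply: (lincomb2 9 (19 - 4 * x) hx5 h11); ring.
case/eqP: (mulf_neq0 two_neq0 four_neq0).
by rewrite ex in hx; apply: (lincomb1 1 hx); ring.
Qed.

End Elimination.

(** * The polynomial F_n in characteristic p *)

Lemma sum_multiples (V : nmodType) (m n : nat) (E : nat -> V) : (0 < m)%N ->
  \sum_(0 <= a < n * m | (m %| a)%N) E a = \sum_(b < n) E (m * b)%N.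
Proof.
move=> m_gt0; elim: n => [|n IHn]; first by rewrite mul0n big_geq ?big_ord0.
rewrite big_ord_recr -IHn /= mulSn addnC.
rewrite (@big_cat_nat _ _ _ (n * m)%N) ?leq_addr //=; congr (_ + _).
rewrite big_ltn_cond; last by rewrite -[X in (X < _)%N]addn0 ltn_add2l.
rewrite dvdn_mull // mulnC big_nat_cond big_pred0 ?addr0 // => a.
apply/negP => /andP[/andP[lt_a a_lt] /dvdnP[k def_a]]; subst a.
rewrite addnC -mulnS [(k * m)%N]mulnC ltn_pmul2l // ltnS in a_lt.
by rewrite mulnC ltn_pmul2r // ltnNge a_lt in lt_a.
Qed.

Lemma sum_coprime (V : zmodType) (p q : nat) (E : nat -> V) :
  prime p -> prime q -> p != q ->
  \sum_(0 <= a < p * q | coprime a (p * q)%N) E a =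
  \sum_(a < p * q) E a - \sum_(b < q) E (p * b)%N - \sum_(b < p) E (q * b)%N
    + E 0%N.
Proof.
move=> p_pr q_pr p'q.
have [p_gt0 q_gt0] := (prime_gt0 p_pr, prime_gt0 q_pr).
have co_pq : coprime p q by rewrite prime_coprime // dvdn_prime2.
rewrite -(sum_multiples _ E p_gt0) -(sum_multiples _ E q_gt0) [(q * p)%N]mulnC.
have -> : E 0%N = \sum_(0 <= a < p * q | (p * q %| a)%N) E a.
  have pq_gt0 : (0 < p * q)%N by rewrite muln_gt0 p_gt0.
  by have := sum_multiples 1 E pq_gt0; rewrite mul1n big_ord1 muln0.
rewrite -(big_mkord xpredT E).
rewrite [LHS]big_mkcond [X in _ - X - _ + _]big_mkcond.
rewrite [X in _ - X + _]big_mkcond [X in _ = _ + X]big_mkcond -!sumrB -big_split /=.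
apply: eq_bigr => a _.
rewrite coprimeMr ![coprime a _]coprime_sym !prime_coprime // Gauss_dvd //.
by do 2!case: (_ %| a)%N; rewrite /= ?subr0 ?subrr ?sub0r ?addr0 ?addNr.
Qed.

Lemma mulrn_pred_pchar (R : nzRingType) (p : nat) (a : R) :
  p \in [pchar R] -> a *+ p.-1 = - a.
Proof.
move=> charR; apply/eqP; rewrite -addr_eq0 -mulrSr.
by rewrite prednK ?mulrn_pchar // prime_gt0 // (pcharf_prime charR).
Qed.

Lemma mulrn_pred2_pchar (R : nzRingType) (p : nat) (a : R) :
  p \in [pchar R] -> a *+ p.-2 = - (a *+ 2).
Proof.
move=> charR; have p_gt1 := prime_gt1 (pcharf_prime charR).
apply/eqP; rewrite -addr_eq0 -mulrnDr (_ : (p.-2 + 2 = p)%N) ?mulrn_pchar //.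
by rewrite addn2 -[p in RHS](subnKC p_gt1) -{1}(subnKC p_gt1).
Qed.

Lemma dvdp_exp_XsubC_deriv (K : fieldType) (P : {poly K}) (x : K) (n : nat) :
  ('X - x%:P) ^+ n.+1 %| P -> ('X - x%:P) ^+ n %| P^`().
Proof.
case/dvdpP=> Q ->; rewrite derivM deriv_exp derivXsubC mul1r.
by rewrite mulrnAr -mulrnAl dvdp_add // dvdp_mull // exprS dvdp_mull.
Qed.

Lemma dvdp_XsubC_horner (K : fieldType) (P : {poly K}) (x : K) (n : nat) :
  ('X - x%:P) ^+ n.+1 %| P -> P.[x] = 0.
Proof.
move=> dvdP; apply/rootP; rewrite -dvdp_XsubCl.
by apply: dvdp_trans dvdP; rewrite exprS dvdp_mulr.
Qed.

(** The evaluation rules for powers come before [hornerM], which would otherwise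
    unfold them. *)
Definition horner_simp := (hornerXn, horner_exp, hornerMn, hornerD, hornerN,
  hornerX, hornerC, hornerM).

Section CharP.

Variables (K : fieldType) (p : nat).
Hypothesis charK : p \in [pchar K].
Hypothesis p_gt5 : (5 < p)%N.

Let p_pr : prime p := pcharf_prime charK.

Local Notation F := (map_poly intr (F_poly (p * 5)) : {poly K}).
Local Notation u := ('X^5 - 1 : {poly K}).

Lemma small_neq0 (n : nat) : (0 < n < p)%N -> (n%:R : K) != 0.
Proof.
by case/andP=> n0 np; rewrite -(dvdn_pcharf charK) gtnNdvd.
Qed.

(** Inclusion-exclusion gives [F_n] as a combination of geometric sums, and in
    characteristic [p] these are powers of [u] and of [Phi5 'X]. *)
Lemma map_F_poly :
  ('X - 1) * F =
  u ^+ p - ('X - 1) * Phi5 'X ^+ p - ('X - 1) * u ^+ p.-1 + ('X - 1).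
Proof.
have charP : p \in [pchar {poly K}] by rewrite pchar_poly.
have u0 : 'X^5 - 1 != 0 :> {poly K}.
  by rewrite -size_poly_eq0 size_XnsubC.
have p0 := prime_gt0 p_pr.
have subXp (P : {poly K}) : P ^+ p - 1 = (P - 1) ^+ p.
  by rewrite -!(pFrobenius_autE charP) rmorphB rmorph1.
rewrite /F_poly sum_coprime //; last by apply/eqP; lia.
rewrite !rmorphD !rmorphN !rmorph_sum /=.
under eq_bigr do rewrite map_polyXn.
under [X in _ - X - _]eq_bigr do rewrite map_polyXn exprM.
under [X in _ - _ - X]eq_bigr do rewrite map_polyXn exprM.
rewrite map_polyXn expr0.
rewrite mulrDr !mulrBr -subrX1 mulr1 mulnC exprM subXp.
congr (_ - _ - _ + _); congr (_ * _).
  rewrite /Phi5 !big_ord_recr big_ord0 /= add0r expr0 expr1.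
  by rewrite -!(pFrobenius_autE charP) !rmorphD !rmorphXn !rmorph1.
apply: (mulfI u0); rewrite -exprS prednK //.
by rewrite -subrX1 subXp.
Qed.

Lemma deriv_expp (P : {poly K}) : (P ^+ p)^`() = 0.
Proof.
have charP : p \in [pchar {poly K}] by rewrite pchar_poly.
by rewrite deriv_exp mulrn_pchar.
Qed.

Lemma deriv_map_F_poly :
  (('X - 1) * F)^`() =
  1 - Phi5 'X ^+ p - u ^+ p.-1 + ('X - 1) * ('X^4 *+ 5) * u ^+ p.-2.
Proof.
have charP : p \in [pchar {poly K}] by rewrite pchar_poly.
rewrite map_F_poly !derivD !derivN !derivM !deriv_expp deriv_exp.
rewrite mulrn_pred_pchar // !derivD !derivN derivXn derivX -polyC1 derivC /=.
by ring.
Qed.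

Lemma deriv2_map_F_poly :
  (('X - 1) * F)^`()^`() =
    ('X^4 *+ 10 + ('X - 1) * 'X^3 *+ 20) * u ^+ p.-2
    - (('X - 1) * 'X^8 *+ 50) * u ^+ p.-2.-1.
Proof.
have charP : p \in [pchar {poly K}] by rewrite pchar_poly.
rewrite deriv_map_F_poly.
(* [q] is generalized so that [derivM] does not unfold the power of ['X]. *)
have [q Dq] : {q : {poly K} | q = 'X^4 *+ 5} by eexists.
have dq : q^`() = 'X^3 *+ 20 by rewrite Dq derivMn derivXn -mulrnA.
rewrite -Dq !derivD !derivN !derivM dq deriv_expp !deriv_exp.
rewrite mulrn_pred_pchar // mulrn_pred2_pchar // !derivD !derivN derivXn.
rewrite derivX -polyC1 derivC.
by rewrite Dq /=; ring.
Qed.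

Lemma repeated_root_eqs (x : K) (v := x ^+ 5 - 1) : ('X - x%:P) ^+ 2 %| F ->
  v ^+ p - (x - 1) * Phi5 x ^+ p - (x - 1) * v ^+ p.-1 + (x - 1) = 0 /\
  1 - Phi5 x ^+ p - v ^+ p.-1 + (x - 1) * (x ^+ 4 *+ 5) * v ^+ p.-2 = 0.
Proof.
have PhiX : (Phi5 'X).[x] = Phi5 x by rewrite /Phi5 -polyC1 !horner_simp.
move/(dvdp_mull ('X - 1)) => dvdG; split.
  rewrite -(dvdp_XsubC_horner dvdG) map_F_poly // -polyC1.
  by rewrite -PhiX !horner_simp.
rewrite -(dvdp_XsubC_horner (dvdp_exp_XsubC_deriv dvdG)) deriv_map_F_poly.
by rewrite -polyC1 -PhiX !horner_simp.
Qed.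

Lemma triple_root_eq (x : K) (v := x ^+ 5 - 1) : ('X - x%:P) ^+ 3 %| F ->
  (x ^+ 4 *+ 10 + (x - 1) * x ^+ 3 *+ 20) * v ^+ p.-2
    - ((x - 1) * x ^+ 8 *+ 50) * v ^+ p.-2.-1 = 0.
Proof.
move/(dvdp_mull ('X - 1)) => dvdG.
rewrite -(dvdp_XsubC_horner (dvdp_exp_XsubC_deriv (dvdp_exp_XsubC_deriv dvdG))).
by rewrite deriv2_map_F_poly -polyC1 !horner_simp.
Qed.

Lemma frobenius_Phi5 (x : K) : Phi5 x ^+ p = Phi5 (x ^+ p).
Proof.
by rewrite /Phi5 -!(pFrobenius_autE charK) !rmorphD !rmorphXn rmorph1.
Qed.

Lemma frobenius_sub1 (x : K) : (x - 1) ^+ p = x ^+ p - 1.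
Proof. by rewrite -!(pFrobenius_autE charK) rmorphB rmorph1. Qed.

(** At a repeated root [x] of [F_n], the two equations [G = G' = 0] combine to
    [u ^+ 2 = 5 * x ^+ 4 * (x - 1) ^+ 2], that is [s ^+ 2 = 5]; then [eps] is
    the sign by which Frobenius acts on [s], and the last relation is [G = 0]
    written in [x], [y] and [s]. *)
Lemma repeated_root_relations (x : K) (y := x ^+ p) :
  ('X - x%:P) ^+ 2 %| F ->
  exists s eps : K,
  [/\ s ^+ 2 = 5, eps = 1 \/ eps = -1, x != 0 /\ x - 1 != 0,
      Phi5 x = s * x ^+ 2 /\ Phi5 y = eps * s * y ^+ 2
    & eps * s * x ^+ 2 * y ^+ 2 * (y - x) - eps * (y - 1) * y ^+ 2
    + (x - 1) * x ^+ 2 = 0].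
Proof.
case/repeated_root_eqs; set v := x ^+ 5 - 1 => h0 h1.
have n4 : (4 : K) != 0 by apply: small_neq0; lia.
have n5 : (5 : K) != 0 by apply: small_neq0; lia.
have odd_p : odd p by case: (even_prime p_pr) => // p2; move: p_gt5; rewrite p2.
have p_gt0 : (0 < p)%N by lia.
have dv : v = (x - 1) * Phi5 x by rewrite /v /Phi5; ring.
have vp : v ^+ p = v ^+ p.-2 * v ^+ 2 by rewrite -exprD; congr (_ ^+ _); lia.
have vp1 : v ^+ p.-1 = v ^+ p.-2 * v by rewrite -exprSr; congr (_ ^+ _); lia.
have x1 : x - 1 != 0.
  apply: contraNneq n4 => x1; apply/eqP.
  have v0 : v = 0 by rewrite dv x1 mul0r.
  have ex : x = 1 by apply: subr0_eq.
  move: h1; rewrite vp1 v0 mulr0 x1 !mul0r frobenius_Phi5 ex expr1n /Phi5.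
  by rewrite !expr1n => h1; apply: (lincomb1 (- 1) h1); ring.
have v0 : v != 0.
  apply: contraNneq x1 => v0; move/eqP: (v0).
  rewrite dv mulf_eq0 => /orP[// | /eqP Phi0].
  have p1_gt0 : (0 < p.-1)%N by lia.
  move: h0; rewrite v0 Phi0 !expr0n !gtn_eqF // !mulr0 !subr0 add0r.
  by move=> ->.
have x0 : x != 0.
  apply/eqP => ex; move/eqP: h1; apply/negP.
  have vN1 : v = -1 by rewrite /v ex expr0n sub0r.
  have Phi1 : Phi5 x = 1 by rewrite /Phi5 ex !expr0n !addr0.
  have even_p1 : odd p.-1 = false by rewrite -subn1 oddB // odd_p.
  rewrite Phi1 vN1 ex expr0n mul0rn mulr0 mul0r addr0 expr1n subrr sub0r.
  by rewrite -signr_odd even_p1 expr0 oppr_eq0 oner_eq0.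
have hPhi : Phi5 x ^+ 2 = 5 * x ^+ 4.
  apply: (mulfI (mulf_neq0 (expf_neq0 p.-2 v0) (expf_neq0 2 x1))).
  rewrite vp vp1 dv in h0 h1 *.
  by apply: (lincomb2 1 (- (x - 1)) h0 h1); ring.
pose s := Phi5 x / x ^+ 2.
have hs : s ^+ 2 = 5.
  by rewrite /s expr_div_n hPhi -exprM mulfK // expf_neq0.
have hx : Phi5 x = s * x ^+ 2 by rewrite divfK ?expf_neq0.
have s0 : s != 0 by apply: contraNneq n5 => s0; rewrite -hs s0 expr0n.
have [eps [heps hsp]] :
    exists eps : K, (eps = 1 \/ eps = -1) /\ s ^+ p = eps * s.
  have : (s ^+ p) ^+ 2 == s ^+ 2.
    by rewrite -exprM mulnC exprM hs -(pFrobenius_autE charK) rmorph_nat.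
  rewrite eqf_sqr => /orP[] /eqP ->; [exists 1 | exists (-1)].
    by rewrite mul1r; split; [left|].
  by rewrite mulN1r; split; [right|].
have hy : Phi5 y = eps * s * y ^+ 2.
  by rewrite -frobenius_Phi5 hx exprMn hsp -!exprM mulnC.
exists s, eps; split=> //.
have vpy : v ^+ p = (y - 1) * (eps * s * y ^+ 2).
  by rewrite dv exprMn frobenius_sub1 frobenius_Phi5 hy.
have hU : (x - 1) * x ^+ 2 * v ^+ p.-1 = eps * (y - 1) * y ^+ 2.
  apply: (mulfI s0); transitivity (v ^+ p); last by rewrite vpy; ring.
  by rewrite vp vp1 dv hx; ring.
rewrite frobenius_Phi5 -/y vpy hy in h0.
by apply: (lincomb2 (x ^+ 2) 1 h0 hU); ring.
Qed.

(** A repeated root of [P] fixed by Frobenius would be a root of the cofactor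
    [D], hence a triple root of [F_n]. *)
Lemma no_repeated_root (x : K) (P D : {poly K}) :
  F = P * D ->
  (forall z : K, z - 1 != 0 -> Phi5 z != 0 -> z ^+ p.-1 = 1 -> root D z) ->
  ~~ (('X - x%:P) ^+ 2 %| P).
Proof.
move=> dF rootD; apply/negP=> dvdP.
have dvdF : ('X - x%:P) ^+ 2 %| F by rewrite dF dvdp_mulr.
have n2 : (2 : K) != 0 by apply: small_neq0; lia.
have n5 : (5 : K) != 0 by apply: small_neq0; lia.
have [s [eps [hs heps [x0 x1] [hx hy] hA]]] := repeated_root_relations dvdF.
have s0 : s != 0 by apply: contraNneq n5 => s0; rewrite -hs s0 expr0n.
have y0 : x ^+ p != 0 by rewrite expf_neq0.
have char_eq (q : nat) : prime q -> (q%:R : K) = 0 -> p = q.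
  move=> q_pr /eqP; rewrite -(dvdn_pcharf charK) dvdn_prime2 //.
  by move/eqP.
case: heps => heps; rewrite {eps}heps in hy hA.
  rewrite !mul1r in hy hA.
  have hxp := pos_sign_elimination n2 n5 x0 y0 hs hx hy hA.
  have hxp1 : x ^+ p.-1 = 1.
    by apply: (mulfI x0); rewrite -exprS prednK ?prime_gt0 // hxp mulr1.
  have Phi0 : Phi5 x != 0 by rewrite hx mulf_neq0 ?expf_neq0.
  have dvd3F : ('X - x%:P) ^+ 3 %| F.
    by rewrite dF exprSr dvdp_mul // dvdp_XsubCl rootD.
  have h2 := triple_root_eq dvd3F.
  set v := x ^+ 5 - 1 in h2.
  have dv : v = (x - 1) * (s * x ^+ 2) by rewrite -hx /v /Phi5; ring.
  clearbody v.
  have v0 : v != 0 by rewrite dv !mulf_neq0 ?expf_neq0.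
  have vp2 : v ^+ p.-2 = v ^+ p.-2.-1 * v.
    by rewrite -exprSr prednK //; clear -p_gt5; lia.
  have ht : s * (3 * x - 2) = 5 * x ^+ 3.
    apply: (mulfI (mulf_neq0 (mulf_neq0 n2 n5)
      (mulf_neq0 (expf_neq0 p.-2.-1 v0) (mulf_neq0 x1 (expf_neq0 5 x0))))).
    rewrite vp2 in h2; move: (v ^+ _) h2 => V h2; rewrite dv in h2.
    by apply: (lincomb1 1 h2); ring.
  have [h11 hx11] := triple_root_elimination n2 n5 hs x0 x1 hx ht.
  apply: (no_triple_root_char11 n2 h11 hx11).
  by rewrite -hxp1 (char_eq 11%N).
rewrite !mulN1r in hy hA.
have [] := @neg_sign_elimination _ n2 n5 x (x ^+ p) s x0 y0 hs hx hy.
  by rewrite -[RHS]hA; ring.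
move=> h17 h1 h2; have p17 : p = 17%N by apply: char_eq.
have char17 : 17%N \in [pchar K] by rewrite -p17.
by rewrite p17 in h1 h2; apply: (no_repeated_root_char17 char17 erefl h1 h2).
Qed.

End CharP.

(** * From the reduction modulo p to the integers *)

Lemma pchar0_deriv_neq0 (F : fieldType) (P : {poly F}) :
  [pchar F] =i pred0 -> (1 < size P)%N -> P^`() != 0.
Proof.
move=> charF P_gt1; apply/eqP => /(congr1 (fun Q : {poly F} => Q`_(size P).-2)).
apply/eqP; rewrite coef_deriv coef0 -mulr_natr mulf_neq0 //.
  have -> : (size P).-2.+1 = (size P).-1.
    by move: P_gt1; case: (size P) => [|[]].
  by rewrite -lead_coefE lead_coef_eq0 -size_poly_gt0 ltnW.
by move/pcharf0P: charF => ->.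
Qed.

(** Gauss's lemma: a square dividing a monic integer polynomial over the
    rationals divides it over the integers, with a unit as leading coefficient.
    *)
Lemma monic_square_dvdp (f : {poly int}) (U : {poly rat}) :
  f \is monic -> U ^+ 2 %| map_poly intr f ->
  exists u r : {poly int},
    [/\ f = u ^+ 2 * r, lead_coef u \is a GRing.unit & size u = size U].
Proof.
move=> f_monic; have [q [a a0 ->]] := rat_poly_scale U.
rewrite exprZn dvdpZl ?expf_neq0 ?invr_eq0 ?intr_eq0 // -rmorphXn dvdp_rat_int.
case/dvdpP_int => r Df; exists (zprimitive q), r.
have {}Df : f = zprimitive q ^+ 2 * r by rewrite expr2 -zprimitiveM.
split=> //; last first.
  by rewrite size_zprimitive size_scale ?size_rat_int_poly // invr_eq0 intr_eq0.
have /eqP := monicP f_monic; rewrite Df !lead_coefM -mulrA => /eqP lc1.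
by apply/unitrPr; exists (lead_coef (zprimitive q) * lead_coef r).
Qed.

(** A repeated root over [algC] makes [f] divisible by the square of a
    nonconstant integer polynomial, whose reduction is still nonconstant since
    its leading coefficient is a unit. *)
Lemma separable_Z_of_reduction (K : closedFieldType) (f : {poly int}) :
  f \is monic -> ~ has_repeated_root (map_poly intr f : {poly K}) ->
  separable_Z f.
Proof.
move=> f_monic sepK.
have sepQ : separable_poly (map_poly intr f : {poly rat}).
  apply/separable_polyP; split; last first.
    by move=> U _; apply: pchar0_deriv_neq0; apply: Num.Theory.pchar_num.
  apply/poly_square_freeP => U sizeU; apply/negP.
  case/(monic_square_dvdp f_monic) => u [r [Df lc_u size_u]].
  have lcK : (lead_coef u)%:~R != 0 :> K by rewrite -unitfE rmorph_unit.
  have /closed_rootP[x] : size (map_poly intr u : {poly K}) != 1%N.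
    by rewrite size_map_poly_id0 ?size_u.
  rewrite -dvdp_XsubCl => dvd_u; apply: sepK; exists x.
  by rewrite Df rmorphM rmorphXn /= dvdp_mulr // dvdp_exp2r.
case=> x; apply/negP; rewrite separable_nosquare ?size_XsubC //.
have -> : map_poly intr f = map_poly (ratr : rat -> algC) (map_poly intr f).
  by rewrite -map_poly_comp; apply: eq_map_poly => c /=; rewrite ratr_int.
by rewrite separable_map.
Qed.

(** * Trace polynomials *)

Section TraceLift.

Variable R : comNzRingType.

(** The polynomial [X ^ N * g (X + 1 / X)]; it has the intended value when
    [size g <= N]. *)
Definition trace_lift (N : nat) (g : {poly R}) : {poly R} :=
  \sum_(i < N) g`_i *: (('X^2 + 1) ^+ i * 'X^(N - i)).

Lemma trace_liftX (N : nat) (g : {poly R}) :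
  trace_lift N.+1 ('X * g) = ('X^2 + 1) * trace_lift N g.
Proof.
rewrite /trace_lift big_ord_recl coefXM scale0r add0r mulr_sumr.
apply: eq_bigr => i _; rewrite coefXM /= subSS [X in X * 'X^_]exprS -mulrA.
by rewrite scalerAr add0n.
Qed.

Lemma trace_liftS (N : nat) (g : {poly R}) :
  (size g <= N)%N -> trace_lift N.+1 g = 'X * trace_lift N g.
Proof.
move=> leN; rewrite /trace_lift big_ord_recr /= (nth_default _ leN) scale0r.
rewrite addr0 mulr_sumr; apply: eq_bigr => i _.
by rewrite subSn ?(ltnW (ltn_ord i)) // (exprS 'X (N - i)) mulrCA scalerAr.
Qed.

Lemma trace_lift_XsubC (N : nat) (b : R) (h : {poly R}) : (size h <= N)%N ->
  trace_lift N.+1 (('X - b%:P) * h) = ('X^2 + 1 - b *: 'X) * trace_lift N h.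
Proof.
move=> leN; rewrite 2!mulrBl -trace_liftX -scalerAl -trace_liftS //.
rewrite /trace_lift scaler_sumr -sumrB.
by apply: eq_bigr => i _; rewrite coefB mul_polyC coefZ scalerBl scalerA.
Qed.

End TraceLift.

Lemma map_trace_lift (R S : comNzRingType) (phi : {rmorphism R -> S})
    (N : nat) (g : {poly R}) :
  map_poly phi (trace_lift N g) = trace_lift N (map_poly phi g).
Proof.
rewrite /trace_lift rmorph_sum; apply: eq_bigr => i _ /=.
rewrite map_polyZ coef_map rmorphM rmorphXn /= rmorphD rmorph1 /=.
by rewrite !map_polyXn.
Qed.

Lemma tofrac_trace_lift (N : nat) (g : {poly int})
    (x := tofrac 'X : {fraction {poly int}}) : (size g <= N)%N ->
  tofrac (trace_lift N g) = x ^+ N * (map_poly intr g).[x + x^-1].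
Proof.
move=> leN; have x0 : x != 0 by rewrite tofrac_eq0 polyX_eq0.
rewrite (horner_coef_wide _ (leq_trans (size_poly _ _) leN)).
rewrite rmorph_sum mulr_sumr.
apply: eq_bigr => i _; rewrite coef_map -mul_polyC !rmorphM !rmorphXn /=.
rewrite rmorphD rmorph1 rmorphXn /= -/x.
rewrite -[g`_i in LHS]intz !rmorph_int [RHS]mulrCA; congr (_ * _).
rewrite -[X in _ = x ^+ X * _](subnK (ltnW (ltn_ord i))) exprD mulrC -mulrA.
congr (_ * _).
by rewrite -exprMn mulrDr mulfV.
Qed.

(** A repeated root [b] of [g] gives [f] the square factor [('X^2 + 1 - b *:
    'X) ^+ 2], up to a power of ['X], which does not vanish at the roots of the
    factor. *)
Lemma separable_Z_trace (f g : {poly int}) :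
  is_trace_poly f g -> separable_Z f -> separable_Z g.
Proof.
rewrite /is_trace_poly; set m := _./2; set x := tofrac 'X => /= fg sepf [b].
case/dvdpP => Q; rewrite mulrC expr2 -mulrA => gQ; apply: sepf.
have x0 : x != 0 by rewrite tofrac_eq0 polyX_eq0.
have fgZ N : (size g <= N)%N -> 'X^m * trace_lift N g = 'X^N * f.
  move=> leN; apply/eqP; rewrite -tofrac_eq !tofracM tofrac_trace_lift //.
  by rewrite !tofracXn -/x fg [X in X == _]mulrCA mulVKf ?expf_neq0.
pose M := (size g + size Q)%N; pose N := M.+2.
pose q : {poly algC} := 'X^2 + 1 - b *: 'X.
have fgC : 'X^m * (q ^+ 2 * trace_lift M Q) = 'X^N * map_poly intr f.
  rewrite -[X in _ = X * _](map_polyXn intr) -rmorphM -fgZ; last first.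
    by rewrite /N /M; lia.
  rewrite rmorphM /= map_polyXn map_trace_lift gQ !trace_lift_XsubC ?leq_addl //.
    by rewrite (expr2 q) -mulrA.
  rewrite (leq_trans (size_polyMleq _ _)) // size_XsubC /= /M.
  by rewrite ltnS leq_addl.
have size_q : size q = 3.
  rewrite /q -addrA size_polyDl size_polyXn // -polyC1 ltnS.
  rewrite (leq_trans (size_polyD _ _)) // geq_max size_polyN.
  rewrite (leq_trans (size_polyC_leq1 _)) //.
  by rewrite (leq_trans (size_scale_leq _ _)) ?size_polyX.
have /closed_rootP[c qc] : size q != 1%N by rewrite size_q.
have c0 : c != 0.
  apply: contraTneq qc => ->; rewrite /root hornerD hornerN hornerZ hornerX.
  by rewrite mulr0 subr0 hornerD hornerXn hornerC expr0n add0r oner_eq0.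
exists c.
have coX : coprimep (('X - c%:P) ^+ 2) ('X^N : {poly algC}).
  apply/coprimep_expl/coprimep_expr; rewrite coprimep_sym coprimep_XsubC.
  by rewrite /root hornerX.
rewrite -(Gauss_dvdpr _ coX) -fgC dvdp_mull // dvdp_mulr // dvdp_exp2r //.
by rewrite dvdp_XsubCl.
Qed.

(** * The cofactor of f *)

Lemma F_poly_monic (n : nat) : (1 < n)%N -> F_poly n \is monic.
Proof.
case: n => [|[|n]] // _.
rewrite /F_poly big_mkcond big_nat_recr //= coprimenS monicE lead_coefDr.
  by rewrite lead_coefXn.
rewrite size_polyXn ltnS; apply: (leq_trans (size_sum _ _ _)).
apply/bigmax_leqP_seq => i; rewrite mem_index_iota => /andP[_ lt_i] _.
by case: ifP; rewrite ?size_poly0 ?size_polyXn.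
Qed.

Lemma is_f_poly_monic (p q : nat) (f : {poly int}) :
  (1 < p * q)%N -> is_f_poly p q f -> f \is monic.
Proof.
move=> pq_gt1 Ff; have := F_poly_monic pq_gt1; rewrite Ff -mulrA monicMr //.
by rewrite monicMl ?monicX // monic_prod // => d _; apply: Cyclotomic_monic.
Qed.

Lemma root_map_prod (K : fieldType) (r : seq nat) (z : K) :
  root (map_poly intr (\prod_(d <- r) 'Phi_d)) z =
  has (fun d => root (map_poly intr 'Phi_d) z) r.
Proof.
rewrite rmorph_prod /=; elim: r => [|d r IHr] /=.
  by rewrite big_nil rootC oner_eq0.
by rewrite big_cons rootM IHr.
Qed.

Lemma root_Phi_dvd (K : fieldType) (n d : nat) (z : K) :
  (0 < n)%N -> (d %| n)%N -> root (map_poly intr 'Phi_d) z -> z ^+ n = 1.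
Proof.
move=> n_gt0 d_n rt; apply: subr0_eq.
have : root (map_poly intr (\prod_(e <- divisors n) 'Phi_e)) z.
  by rewrite root_map_prod; apply/hasP; exists d; rewrite // -dvdn_divisors.
rewrite prod_Cyclotomic // rmorphB rmorph1 /= map_polyXn => /rootP.
by rewrite hornerD hornerN hornerXn hornerC.
Qed.

(** The roots of unity of order dividing [p - 1] are roots of the cofactor of
    [f], except 1 and the primitive fifth roots of unity. *)
Lemma root_prod_S_seq (K : fieldType) (p : nat) (z : K) : (1 < p)%N ->
  z - 1 != 0 -> Phi5 z != 0 -> z ^+ p.-1 = 1 ->
  root (map_poly intr (\prod_(d <- S_seq p 5) 'Phi_d)) z.
Proof.
move=> p_gt1 z1 Phiz zp.
have p1_gt0 : (0 < p - 1)%N by rewrite subn_gt0.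
have : root (map_poly intr (\prod_(d <- divisors (p - 1)) 'Phi_d)) z.
  rewrite prod_Cyclotomic // rmorphB rmorph1 /= map_polyXn /root.
  by rewrite hornerD hornerN hornerXn hornerC subn1 zp subrr.
rewrite !root_map_prod => /hasP[d d_p rt]; apply/hasP; exists d => //.
have d_gt0 : (0 < d)%N by apply: (dvdn_gt0 p1_gt0); rewrite dvdn_divisors.
rewrite mem_undup mem_cat mem_filter d_p andbT.
have -> : (1 < d)%N.
  rewrite ltn_neqAle d_gt0 andbT eq_sym; apply: contraNneq z1 => d1.
  by have := @root_Phi_dvd _ 1 d z; rewrite d1 expr1 -d1 => -> //; rewrite subrr.
have -> : d != 5 => //.
apply: contraTneq rt => ->; apply/negP => rt5.
have z5 : z ^+ 5 = 1 by apply: root_Phi_dvd rt5.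
have : (z - 1) * Phi5 z = 0 by apply: (lincomb1 1 z5); rewrite /Phi5; ring.
by apply/eqP; rewrite mulf_neq0.
Qed.

Theorem corollary5p4 (p : nat) (hp : prime p) (hp5 : (5 < p)%N)
    (f : {poly int}) (hf : is_f_poly p 5 f) :
  [/\ separable_mod p f,
      separable_Z f
    & forall g : {poly int}, is_trace_poly f g -> separable_Z g].
Proof.
have charK : p \in [pchar Fp_bar p].
  by apply: (rmorph_pchar (Fp_bar_inj p)); apply: pchar_Fp.
have sepK : ~ has_repeated_root (map_poly intr f : {poly Fp_bar p}).
  case=> x; apply/negP; apply: (@no_repeated_root _ p charK hp5 x _
    (map_poly intr ('X * \prod_(d <- S_seq p 5) 'Phi_d))).
    by rewrite hf -mulrA rmorphM.
  move=> z z1 Phiz zp; rewrite rmorphM rootM root_prod_S_seq ?orbT //.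
  exact: prime_gt1.
have sepZ : separable_Z f.
  apply: separable_Z_of_reduction sepK.
  by apply: is_f_poly_monic hf; rewrite (leq_trans (prime_gt1 hp)) // leq_pmulr.
split=> // [|g fg]; last exact: separable_Z_trace fg sepZ.
rewrite /separable_mod -map_poly_comp.
by rewrite (eq_map_poly (g := intr)) // => c /=; rewrite rmorph_int.
Qed.
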